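(* Let $C \subseteq \mathbb{R}^n$ be a closed convex set, let $P \subseteq \mathbb{R}^n$ be a polyhedron, and let $\varepsilon \geq 0$ be a real number. If $d_{\mathsf{H}}(P,C) \leq \varepsilon$, then $P$ is a homogeneous $\varepsilon$-approximation of $C$.
   Context: A polyhedron is an intersection of finitely many closed halfspaces. $\operatorname{cone} M$ denotes the conical hull of $M$, i.e. the smallest convex cone containing $M$ (cones are closed under multiplication by nonnegative scalars, hence contain $0$; $\operatorname{cone}\emptyset = \{0\}$), and $\operatorname{cl}$ denotes closure. The homogenization of a convex set $C \subseteq \mathbb{R}^n$ is the cone $\operatorname{homog} C = \operatorname{cl}\operatorname{cone}(C \times \{1\}) \subseteq \mathbb{R}^{n+1}$. $B$ denotes the closed Euclidean unit ball of the appropriate dimension, and $d(x,M) = \inf\{\|x-y\| \mid y \in M\}$ with the Euclidean norm. The Hausdorff distance is $d_{\mathsf{H}}(C_1,C_2) = \max\{\sup_{x \in C_1} d(x,C_2), \sup_{x \in C_2} d(x,C_1)\}$ (possibly $+\infty$). The truncated Hausdorff distance of convex cones $K_1,K_2$ is $d_{\mathsf{tH}}(K_1,K_2) = d_{\mathsf{H}}(K_1 \cap B, K_2 \cap B)$. For a convex set $C \subseteq \mathbb{R}^n$ and $\delta \geq 0$, a polyhedron $P \subseteq \mathbb{R}^n$ is a homogeneous $\delta$-approximation of $C$ if $d_{\mathsf{tH}}(\operatorname{homog} P, \operatorname{homog} C) \leq \delta$. *)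

(* Defs.v *)
From HB Require Import structures.
From mathcomp Require Import all_boot all_order all_algebra.
From mathcomp Require Import all_classical all_reals all_analysis.

Set Implicit Arguments.
Unset Strict Implicit.
Unset Printing Implicit Defensive.

Import Order.TTheory GRing.Theory Num.Theory.
Import numFieldNormedType.Exports.

Local Open Scope classical_set_scope.
Local Open Scope ring_scope.

Section Definitions.
Context {R : realType}.

Definition dotp {n : nat} (x y : 'rV[R]_n) : R := \sum_(i < n) x 0 i * y 0 i.

(* The norm `|x| that the library puts on 'rV[R]_n is the sup norm; it induces
   the same topology, so [closed] and [closure] are the usual ones. *)
Definition enorm {n : nat} (x : 'rV[R]_n) : R := Num.sqrt (dotp x x).

Definition eball {n : nat} : set 'rV[R]_n := [set x | enorm x <= 1].

Definition euclid_dist {n : nat} (x : 'rV[R]_n) (M : set 'rV[R]_n) : \bar R :=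
  ereal_inf [set (enorm (x - y))%:E | y in M].

(* As [ereal_inf set0 = +oo] and [ereal_sup set0 = -oo], this is +oo if exactly
   one of the two sets is empty, and -oo (instead of 0) if both are; the latter
   makes no difference for comparisons with a nonnegative bound. *)
Definition hausdorff_dist {n : nat} (C1 C2 : set 'rV[R]_n) : \bar R :=
  maxe (ereal_sup [set euclid_dist x C2 | x in C1])
       (ereal_sup [set euclid_dist x C1 | x in C2]).

Definition truncated_hausdorff_dist {n : nat} (K1 K2 : set 'rV[R]_n) : \bar R :=
  hausdorff_dist (K1 `&` eball) (K2 `&` eball).

Definition closed_halfspace {n : nat} (H : set 'rV[R]_n) : Prop :=
  exists (a : 'rV[R]_n) (b : R), a != 0 /\ H = [set x | dotp a x <= b].

Definition polyhedron {n : nat} (P : set 'rV[R]_n) : Prop :=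
  exists F : set (set 'rV[R]_n),
    [/\ finite_set F, F `<=` closed_halfspace & P = \bigcap_(H in F) H].

Definition convex_cone {n : nat} (K : set 'rV[R]_n) : Prop :=
  [/\ K 0,
      (forall (t : R) (x : 'rV[R]_n), 0 <= t -> K x -> K (t *: x)) &
      convex_set K].

Definition cone {n : nat} (M : set 'rV[R]_n) : set 'rV[R]_n :=
  smallest convex_cone M.

Definition homog {n : nat} (C : set 'rV[R]_n) : set 'rV[R]_(n + 1) :=
  closure (cone [set row_mx x 1%:M | x in C]).

Definition homogeneous_approximation {n : nat} (delta : R)
    (C P : set 'rV[R]_n) : Prop :=
  polyhedron P /\
  (truncated_hausdorff_dist (homog P) (homog C) <= delta%:E)%E.

End Definitions.

(* Main.v *)
Require Import Defs.
From HB Require Import structures.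
From mathcomp Require Import all_boot all_order all_algebra.
From mathcomp Require Import all_classical all_reals all_analysis.
From mathcomp Require Import ring lra.

Set Implicit Arguments.
Unset Strict Implicit.
Unset Printing Implicit Defensive.

Import Order.TTheory GRing.Theory Num.Theory.
Import numFieldNormedType.Exports.

Local Open Scope classical_set_scope.
Local Open Scope ring_scope.

(** A point [u] of [cone (A x {1})] has height [h >= 0], and it lies within
    [e * h] of [cone (D x {1})] whenever [A] is within [e] of [D]: the points
    with this property form a convex cone containing [A x {1}]. Heights in the
    unit ball are at most 1, so, after passing to the closure, every [u] in
    [homog A] and the unit ball is almost within [e] of some [v] in
    [cone (D x {1})]. Replacing [v] by the projection of [u] onto the ray
    through [v] moves it into the unit ball without increasing the distance. *)

Lemma dotpC (R : realType) (n : nat) (x y : 'rV[R]_n) : dotp x y = dotp y x.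
Proof. by apply: eq_bigr => i _; rewrite mulrC. Qed.

Lemma dotpDl (R : realType) (n : nat) (x y z : 'rV[R]_n) :
  dotp (x + y) z = dotp x z + dotp y z.
Proof. by rewrite -big_split; apply: eq_bigr => i _; rewrite mxE mulrDl. Qed.

Lemma dotpZl (R : realType) (n : nat) (a : R) (x z : 'rV[R]_n) :
  dotp (a *: x) z = a * dotp x z.
Proof. by rewrite mulr_sumr; apply: eq_bigr => i _; rewrite mxE mulrA. Qed.

Lemma dotpDr (R : realType) (n : nat) (x y z : 'rV[R]_n) :
  dotp z (x + y) = dotp z x + dotp z y.
Proof. by rewrite dotpC dotpDl !(dotpC z). Qed.

Lemma dotpZr (R : realType) (n : nat) (a : R) (x z : 'rV[R]_n) :
  dotp z (a *: x) = a * dotp z x.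
Proof. by rewrite dotpC dotpZl (dotpC z). Qed.

Lemma dotp_ge0 (R : realType) (n : nat) (x : 'rV[R]_n) : 0 <= dotp x x.
Proof. by apply: sumr_ge0 => i _; rewrite -expr2 sqr_ge0. Qed.

Lemma dotp_eq0 (R : realType) (n : nat) (x : 'rV[R]_n) : dotp x x = 0 -> x = 0.
Proof.
move=> /eqP; rewrite psumr_eq0; last by move=> i _; rewrite -expr2 sqr_ge0.
move=> /allP x0; apply/rowP => i; apply/eqP; rewrite mxE.
by have := x0 i (mem_index_enum i); rewrite /= mulf_eq0 orbb.
Qed.

Lemma dotp_addZ (R : realType) (n : nat) (a b : R) (x y : 'rV[R]_n) :
  dotp (a *: x + b *: y) (a *: x + b *: y) =
  a ^+ 2 * dotp x x + 2 * a * b * dotp x y + b ^+ 2 * dotp y y.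
Proof. rewrite !(dotpDl, dotpDr, dotpZl, dotpZr) (dotpC y x); ring. Qed.

Lemma dotp_subZ (R : realType) (n : nat) (t : R) (x y : 'rV[R]_n) :
  dotp (x - t *: y) (x - t *: y) =
  dotp x x - 2 * t * dotp x y + t ^+ 2 * dotp y y.
Proof.
by have := @dotp_addZ R n 1 (- t) x y; rewrite scale1r scaleNr => ->; ring.
Qed.

(** For [y] nonzero, expand the nonnegative [dotp] square of [dotp y y *: x - dotp x y *: y]: it is
    [dotp y y] times the difference of the two sides. *)
Lemma cauchy_schwarz (R : realType) (n : nat) (x y : 'rV[R]_n) :
  dotp x y ^+ 2 <= dotp x x * dotp y y.
Proof.
have [/dotp_eq0 ->|y0] := eqVneq (dotp y y) 0.
  (* The zero vector is written as [0 *: 0], so that [dotpZr] extracts a zero factor. *)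
  by rewrite -(scale0r (0 : 'rV[R]_n)) !dotpZr !mul0r mulr0 expr0n.
have y_gt0 : 0 < dotp y y by rewrite lt_def y0 dotp_ge0.
have := dotp_ge0 (dotp y y *: x + (- dotp x y) *: y).
rewrite dotp_addZ.
suff -> : dotp y y ^+ 2 * dotp x x + 2 * dotp y y * - dotp x y * dotp x y +
    (- dotp x y) ^+ 2 * dotp y y =
    dotp y y * (dotp x x * dotp y y - dotp x y ^+ 2).
  by rewrite pmulr_rge0 // subr_ge0.
ring.
Qed.

Lemma enorm_ge0 (R : realType) (n : nat) (x : 'rV[R]_n) : 0 <= enorm x.
Proof. exact: sqrtr_ge0. Qed.

Lemma sqr_enorm (R : realType) (n : nat) (x : 'rV[R]_n) :
  enorm x ^+ 2 = dotp x x.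
Proof. by rewrite sqr_sqrtr ?dotp_ge0. Qed.

Lemma enorm_le (R : realType) (n : nat) (x : 'rV[R]_n) (r : R) :
  0 <= r -> (enorm x <= r) = (dotp x x <= r ^+ 2).
Proof.
by move=> r0; rewrite -sqr_enorm ler_pXn2r // nnegrE ?enorm_ge0.
Qed.

Lemma enormZ (R : realType) (n : nat) (a : R) (x : 'rV[R]_n) :
  enorm (a *: x) = `|a| * enorm x.
Proof.
by rewrite /enorm dotpZl dotpZr mulrA -expr2 sqrtrM ?sqr_ge0 // sqrtr_sqr.
Qed.

Lemma enorm0 (R : realType) (n : nat) : enorm (0 : 'rV[R]_n) = 0.
Proof. by rewrite -(scale0r 0) enormZ normr0 mul0r. Qed.

Lemma enormD (R : realType) (n : nat) (x y : 'rV[R]_n) :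
  enorm (x + y) <= enorm x + enorm y.
Proof.
rewrite enorm_le ?addr_ge0 ?enorm_ge0 //.
have xy : dotp x y <= enorm x * enorm y.
  rewrite (le_trans (ler_norm _)) // -sqrtr_sqr -sqrtrM ?dotp_ge0 //.
  by rewrite ler_sqrt ?mulr_ge0 ?dotp_ge0 // cauchy_schwarz.
have := dotp_addZ 1 1 x y; rewrite !scale1r => ->.
rewrite -!sqr_enorm; nra.
Qed.

Lemma enorm_distD (R : realType) (n : nat) (y x z : 'rV[R]_n) :
  enorm (x - z) <= enorm (x - y) + enorm (y - z).
Proof. by rewrite -[x - z](subrKA y) enormD. Qed.

Lemma enorm_coord (R : realType) (n : nat) (x : 'rV[R]_n) (i : 'I_n) :
  `|x 0 i| <= enorm x.
Proof.
rewrite -sqrtr_sqr ler_sqrt ?dotp_ge0 // /dotp (bigD1 i) //= -expr2 lerDl.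
by apply: sumr_ge0 => j _; rewrite -expr2 sqr_ge0.
Qed.

Lemma enorm_row_mx0 (R : realType) (m n : nat) (x : 'rV[R]_n) :
  enorm (row_mx x (0 : 'rV_m)) = enorm x.
Proof.
congr Num.sqrt; rewrite /dotp big_split_ord /= [X in _ + X]big1 ?addr0.
  by apply: eq_bigr => i _; rewrite row_mxEl.
by move=> i _; rewrite row_mxEr mxE mulr0.
Qed.

(** The topology comes from the sup norm. A sup-norm ball of radius [d = e / (n + 1)] fits in the
    Euclidean ball of radius [e], because [n * d ^+ 2 <= (n + 1) ^+ 2 * d ^+ 2]; using [n + 1] also
    covers dimension 0. *)
Lemma enorm_closure (R : realType) (n : nat) (K : set 'rV[R]_n)
    (u : 'rV[R]_n) (e : R) :
  0 < e -> closure K u -> exists2 v, K v & enorm (u - v) <= e.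
Proof.
move=> e0 Ku; pose d := e / n.+1%:R.
have d0 : 0 < d by rewrite divr_gt0.
have [v [Kv [_ uv]]] := Ku _ (nbhsx_ballx u d d0).
exists v => //; rewrite enorm_le ?(ltW e0) //.
have -> : e = n.+1%:R * d by rewrite mulrC divfK // pnatr_eq0.
apply: (@le_trans _ _ (\sum_(i < n) d ^+ 2)).
  apply: ler_sum => i _; rewrite !mxE -expr2.
  have := uv 0 i; rewrite /ball /= => uvi.
  by rewrite -real_normK ?num_real // ler_sqr ?nnegrE // ltW.
rewrite sumr_const card_ord [leRHS]exprMn -[leLHS]mulr_natl
  ler_wpM2r ?sqr_ge0 //.
by rewrite -natrX ler_nat (leq_trans (leqnSn n)) // -mulnn leq_pmulr.
Qed.

Lemma ray_projection (R : realType) (n : nat) (u v : 'rV[R]_n) :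
  exists2 t : R, 0 <= t &
    enorm (t *: v) <= enorm u /\ enorm (u - t *: v) <= enorm (u - v).
Proof.
have uv := dotp_subZ 1 u v; rewrite scale1r in uv.
(* If the angle is not acute, the nearest point of the ray is its apex, so [t = 0]. *)
have [uv0|uv0] := leP (dotp u v) 0.
  exists 0 => //; rewrite scale0r subr0 enorm0 enorm_ge0; split=> //.
  rewrite enorm_le ?enorm_ge0 // sqr_enorm uv.
  have := dotp_ge0 v; lra.
have v0 : 0 < dotp v v.
  rewrite lt_def dotp_ge0 andbT; apply: contraTneq uv0 => /dotp_eq0 ->.
  by rewrite -(scale0r (0 : 'rV[R]_n)) dotpZr mul0r ltxx.
pose t := dotp u v / dotp v v.
have tv : t * dotp v v = dotp u v by rewrite divfK // gt_eqF.
exists t; first by rewrite divr_ge0 // ltW.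
(* The first bound is Cauchy-Schwarz; in the second, the squared distances differ by
   [(t - 1) ^+ 2 * dotp v v]. *)
rewrite !enorm_le ?enorm_ge0 // !sqr_enorm; split.
  rewrite dotpZl dotpZr tv -(ler_pM2r v0).
  by rewrite mulrAC tv -expr2 cauchy_schwarz.
rewrite dotp_subZ uv -tv.
have := mulr_ge0 (sqr_ge0 (t - 1)) (ltW v0); lra.
Qed.

Lemma cone_convex_cone (R : realType) (n : nat) (M : set 'rV[R]_n) :
  convex_cone (cone M).
Proof.
split.
- by move=> K [[]].
- move=> t x t0 Mx K KM; have [[_ KZ _] _] := KM.
  by apply: KZ => //; exact: Mx.
- move=> x y l /set_mem Mx /set_mem My; apply/mem_set => K KM.
  have [[_ _ Kc] _] := KM.
  by apply: set_mem; apply: Kc; apply: mem_set; [exact: Mx|exact: My].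
Qed.

(** The bound is linear in the height [u 0 (rshift n 0)], hence stable under nonnegative scaling and
    convex combinations; generators have height 1. *)
Lemma cone_near (R : realType) (n : nat) (A D : set 'rV[R]_n) (e : R) :
  (forall a, A a -> exists2 d, D d & enorm (a - d) <= e) ->
  forall u, cone [set row_mx x 1%:M | x in A] u ->
  exists2 v, cone [set row_mx x 1%:M | x in D] v &
    enorm (u - v) <= e * u 0 (rshift n 0).
Proof.
move=> AD.
set KD := cone [set row_mx x _ | x in D].
have [KD0 KDZ KDc] : convex_cone KD := cone_convex_cone _.
apply: smallest_sub; last first.
  move=> _ [a Aa <-]; have [d Dd ad] := AD a Aa.
  exists (row_mx d 1%:M); first by apply: sub_gen_smallest; exists d.
  have -> : row_mx a 1%:M - row_mx d 1%:M = row_mx (a - d) (0 : 'rV_1).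
    by rewrite opp_row_mx add_row_mx addrN.
  by rewrite enorm_row_mx0 row_mxEr mxE eqxx mulr1.
split.
- by exists 0 => //; rewrite subrr enorm0 mxE mulr0.
- move=> t x t0 [v KDv xv]; exists (t *: v); first exact: KDZ.
  by rewrite -scalerBr enormZ ger0_norm // mxE mulrCA ler_wpM2l.
- move=> x y l /set_mem[v KDv xv] /set_mem[w KDw yw]; apply: mem_set.
  have l0 : 0 <= l%:num by [].
  have l1 : 0 <= 1 - l%:num by rewrite subr_ge0.
  exists (l%:num *: v + (1 - l%:num) *: w).
    by apply: set_mem; apply: (KDc v w l); apply: mem_set.
  rewrite -[conv l x y]/(l%:num *: x + (1 - l%:num) *: y).
  rewrite opprD addrACA -!scalerBr (le_trans (enormD _ _)) //.
  rewrite !enormZ !ger0_norm // !mxE mulrDr lerD // mulrCA ler_wpM2l //.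
Qed.

Lemma homog_near (R : realType) (n : nat) (A D : set 'rV[R]_n) (eps e : R) :
  0 <= eps -> 0 < e ->
  (forall a, A a -> (euclid_dist a D <= eps%:E)%E) ->
  forall u, (homog A `&` eball) u ->
  exists2 v, (homog D `&` eball) v & enorm (u - v) <= eps + e.
Proof.
move=> eps0 e0 AD u [Au u1].
(* The slack [h] is spent twice: on leaving the closure and on replacing an infimum by a point. The
   total error is [h + (eps + h) * (1 + h)], at most [eps + h * (3 + eps)] since [h <= 1]. *)
have [h h0 [h1 he]] : exists2 h : R, 0 < h & h <= 1 /\ h * (3 + eps) <= e.
  have c0 : 0 < 3 + eps by lra.
  exists (Num.min 1 (e / (3 + eps))); first by rewrite lt_min ltr01 divr_gt0.
  by split; rewrite -?ler_pdivlMr // ge_min lexx ?orbT.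
have AD' a : A a -> exists2 d, D d & enorm (a - d) <= eps + h.
  move=> Aa; have : (euclid_dist a D < (eps + h)%:E)%E.
    by rewrite (le_lt_trans (AD a Aa)) // lte_fin ltrDl.
  by case/ereal_inf_lt => _ [d Dd <-]; rewrite lte_fin => /ltW; exists d.
have [w Aw uw] := enorm_closure h0 Au.
have [v Dv wv] := cone_near AD' Aw.
(* The height of [w] is at most its norm, and [w] is within [h] of the unit ball. *)
have w_le : w 0 (rshift n 0) <= 1 + h.
  apply: le_trans (ler_norm _) _; apply: le_trans (enorm_coord _ _) _.
  have := enorm_distD u w 0; rewrite !subr0 -opprB -scaleN1r enormZ normrN1.
  move: u1; rewrite /eball /=; lra.
have uv : enorm (u - v) <= eps + e.
  apply: le_trans (enorm_distD w u v) _.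
  have : (eps + h) * w 0 (rshift n 0) <= (eps + h) * (1 + h).
    by rewrite ler_wpM2l // addr_ge0 // ltW.
  nra.
have [t t0 [tv utv]] := ray_projection u v.
exists (t *: v); last exact: le_trans uv.
split; last exact: le_trans u1.
have [_ KZ _] := cone_convex_cone [set row_mx x 1%:M | x in D].
by apply: subset_closure; exact: KZ.
Qed.

Lemma sup_euclid_dist_homog (R : realType) (n : nat) (A D : set 'rV[R]_n)
    (eps : R) :
  0 <= eps -> (ereal_sup [set euclid_dist x D | x in A] <= eps%:E)%E ->
  (ereal_sup [set euclid_dist x (homog D `&` eball) | x in homog A `&` eball]
    <= eps%:E)%E.
Proof.
move=> eps0 AD; apply: ge_ereal_sup => _ [u Au <-].
(* [homog_near] loses an arbitrarily small [e], so the bound is proved for [eps + e] with every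
   [e > 0]. *)
apply/lee_addgt0Pr => e e0.
have AD' a : A a -> (euclid_dist a D <= eps%:E)%E.
  by move=> Aa; apply: le_trans AD; apply: ereal_sup_ubound; exists a.
have [v Dv uv] := homog_near eps0 e0 AD' Au.
apply: (@le_trans _ _ (enorm (u - v))%:E); last by rewrite -EFinD lee_fin.
by apply: ereal_inf_lbound; exists v.
Qed.

Theorem proposition3p4 (R : realType) (n : nat) (C P : set 'rV[R]_n)
    (eps : R) :
  closed C -> convex_set C -> polyhedron P -> 0 <= eps ->
  (hausdorff_dist P C <= eps%:E)%E ->
  homogeneous_approximation eps C P.
Proof.
move=> _ _ polyP eps0; rewrite /hausdorff_dist ge_max => /andP[PC CP].
split=> //; rewrite /truncated_hausdorff_dist /hausdorff_dist ge_max.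
(* The one-sided estimate serves twice, with [P] and [C] exchanged. *)
by rewrite !sup_euclid_dist_homog.
Qed.
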